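(* Let $R$ be a ring and $n\geq 1$ an integer. The map associating to each pre-order $\lesssim$ on $\mathbf{n}=\{1,\dots,n\}$ the corresponding structural matrix ring $M_n(\lesssim,R)$ is an embedding of the lattice of pre-orders on $\mathbf{n}$ into the lattice of subrings of the matrix ring $M_n(R)$ (that is, it is an injective map that preserves binary meets and joins). The embedding also preserves infinite greatest lower bounds and infinite least upper bounds (that is, those of infinite families).
   Context: Rings are possibly non-commutative and have a unit element $1$, with $1\neq 0$. Subrings are required to contain the unit element of the ambient ring. $M_n(R)$ denotes the ring of $n\times n$ matrices over $R$; a matrix is viewed as a map $A$ on $\mathbf{n}^2=\{1,\dots,n\}^2$ with entries $A(i,j)$. A pre-order on a set is a reflexive and transitive binary relation. The set of pre-orders on $\mathbf{n}$ is a lattice, ordered by inclusion (implication) of relations, with minimum the equality relation. The subrings of $M_n(R)$ form a lattice ordered by inclusion. For a pre-order $\lesssim$ on $\mathbf{n}$, the structural matrix ring over $R$ is $$M_n(\lesssim,R)=\{A\in M_n(R): \text{for all } i,j\in\mathbf{n},\ A(i,j)=0 \text{ unless } i\lesssim j\}.$$ *)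

(* Defs.v *)
From HB Require Import structures.
From mathcomp Require Import all_boot all_order all_algebra.
From mathcomp Require Import boolp classical_sets cardinality.

Set Implicit Arguments.
Unset Strict Implicit.
Unset Printing Implicit Defensive.

Import Order.Theory GRing.Theory.

Record preorder_on (T : Type) := PreorderOn {
  preorder_rel :> rel T;
  preorder_refl : reflexive preorder_rel;
  preorder_trans : transitive preorder_rel
}.

Lemma preorder_on_eq (T : Type) (r s : preorder_on T) :
  (forall i j, r i j = s i j) -> r = s.
Proof.
case: r s => [r r1 r2] [s s1 s2] /= rs.
have {}rs : r = s by apply/funext => i; apply/funext => j.
by subst s; congr PreorderOn; exact: Prop_irrelevance.
Qed.

(* Order structures require a choiceType; the instances below are classical,
   and their == decides Leibniz equality. *)
HB.instance Definition _ (T : Type) := gen_eqMixin (preorder_on T).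
HB.instance Definition _ (T : Type) := gen_choiceMixin (preorder_on T).

Section PreorderLattice.
Variable T : finType.
Implicit Types r s t : preorder_on T.

Definition preorder_le r s := [forall i, forall j, r i j ==> s i j].

Lemma preorder_leP r s : reflect (forall i j, r i j -> s i j) (preorder_le r s).
Proof.
by apply: (iffP forallP) => h i; [move=> j; move/forallP: (h i) => /(_ j)/implyP
  | apply/forallP => j; apply/implyP/h].
Qed.

Lemma preorder_le_refl : reflexive preorder_le.
Proof. by move=> r; apply/preorder_leP. Qed.

Lemma preorder_le_anti : antisymmetric preorder_le.
Proof.
move=> r s /andP[/preorder_leP rs /preorder_leP sr].
by apply: preorder_on_eq => i j; apply/idP/idP => [/rs|/sr].
Qed.

Lemma preorder_le_trans : transitive preorder_le.
Proof.
move=> s r t /preorder_leP rs /preorder_leP st.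
by apply/preorder_leP => i j /rs/st.
Qed.

Fact preorder_display : Order.disp_t. Proof. exact: Order.Disp tt tt. Qed.

HB.instance Definition _ := @Order.Le_isPOrder.Build preorder_display
  (preorder_on T) preorder_le preorder_le_refl preorder_le_anti
  preorder_le_trans.

Definition preorder_meet_rel r s : rel T := [rel i j | r i j && s i j].

Lemma preorder_meet_refl r s : reflexive (preorder_meet_rel r s).
Proof. by move=> i; apply/andP; split; exact: preorder_refl. Qed.

Lemma preorder_meet_trans r s : transitive (preorder_meet_rel r s).
Proof.
move=> j i k /= /andP[ij ij'] /andP[jk jk'].
by apply/andP; split; [exact: preorder_trans ij jk | exact: preorder_trans ij' jk'].
Qed.

Definition preorder_meet r s :=
  PreorderOn (@preorder_meet_refl r s) (@preorder_meet_trans r s).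

(* The union of two pre-orders is reflexive but need not be transitive; the
   join is its transitive closure. *)
Definition preorder_join r s :=
  let rs : rel T := [rel i j | r i j || s i j] in
  PreorderOn (@connect0 _ rs) (@connect_trans _ rs).

Lemma preorder_meetP t r s :
  (t <= preorder_meet r s)%O = (t <= r)%O && (t <= s)%O.
Proof.
apply/preorder_leP/andP => [h|[/preorder_leP tr /preorder_leP ts] i j tij].
  by split; apply/preorder_leP => i j /h /andP[].
by apply/andP; split; [exact: tr | exact: ts].
Qed.

Lemma preorder_joinP r s t :
  (preorder_join r s <= t)%O = (r <= t)%O && (s <= t)%O.
Proof.
apply/preorder_leP/andP => [h|[/preorder_leP rt /preorder_leP st] i j].
  by split; apply/preorder_leP => i j ij; apply/h/connect1; rewrite /= ij ?orbT.
case/connectP => p; elim: p i => [|k p IH] i /=.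
  by move=> _ ->; exact: preorder_refl.
case/andP => ik pk /(IH _ pk); apply: preorder_trans.
by case/orP: ik => [/rt|/st].
Qed.

HB.instance Definition _ := @Order.POrder_MeetJoin_isLattice.Build
  preorder_display (preorder_on T) preorder_meet preorder_join
  preorder_meetP preorder_joinP.

(* The lattice of pre-orders is complete, so statements about the infimum or
   supremum of an arbitrary family are never vacuous. *)
Lemma preorder_infimums_nonempty (A : set (preorder_on T)) :
  (infimums A !=set0)%classic.
Proof.
pose m : rel T := [rel i j | `[< forall r, A r -> r i j >]].
have m1 : reflexive m by move=> i; apply/asboolP => r _; exact: preorder_refl.
have m2 : transitive m.
  move=> j i k /asboolP ij /asboolP jk; apply/asboolP => r Ar.
  exact: preorder_trans (ij r Ar) (jk r Ar).
exists (PreorderOn m1 m2); split.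
  by move=> r Ar; apply/preorder_leP => i j /asboolP; exact.
move=> t tA; apply/preorder_leP => i j tij; apply/asboolP => r Ar.
by move/preorder_leP: (tA r Ar); exact.
Qed.

Lemma preorder_supremums_nonempty (A : set (preorder_on T)) :
  (supremums A !=set0)%classic.
Proof.
have [p [p1 p2]] := preorder_infimums_nonempty (ubound A).
by exists p; split=> // r Ar; apply: p2 => s; exact.
Qed.

End PreorderLattice.

Record subring (S : pzRingType) := Subring {
  subring_carrier :> {pred S};
  subringP : subring_closed subring_carrier
}.

Lemma subring_eq (S : pzRingType) (A B : subring S) : A =i B -> A = B.
Proof.
case: A B => [A Ac] [B Bc] AB.
have {}AB : A = B by apply/funext => x; exact: AB.
by subst B; congr Subring; exact: Prop_irrelevance.
Qed.

HB.instance Definition _ (S : pzRingType) := gen_eqMixin (subring S).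
HB.instance Definition _ (S : pzRingType) := gen_choiceMixin (subring S).

Section SubringLattice.
Variable S : pzRingType.
Implicit Types A B C : subring S.

Definition subring_le A B := `[< {subset A <= B} >].

Lemma subring_le_refl : reflexive subring_le.
Proof. by move=> A; apply/asboolP. Qed.

Lemma subring_le_anti : antisymmetric subring_le.
Proof.
move=> A B /andP[/asboolP AB /asboolP BA].
by apply: subring_eq => x; apply/idP/idP => [/AB|/BA].
Qed.

Lemma subring_le_trans : transitive subring_le.
Proof.
by move=> B A C /asboolP AB /asboolP BC; apply/asboolP => x /AB/BC.
Qed.

Fact subring_display : Order.disp_t. Proof. exact: Order.Disp tt tt. Qed.

HB.instance Definition _ := @Order.Le_isPOrder.Build subring_display
  (subring S) subring_le subring_le_refl subring_le_anti subring_le_trans.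

Lemma subring_meet_closed A B : subring_closed [predI A & B].
Proof.
have [[A1 AB AM] [B1 BB BM]] := (subringP A, subringP B).
split=> [|x y|x y]; rewrite !inE.
- by apply/andP.
- by move=> /andP[??] /andP[??]; rewrite AB ?BB.
- by move=> /andP[??] /andP[??]; rewrite AM ?BM.
Qed.

Definition subring_meet A B := Subring (subring_meet_closed A B).

(* The subring generated by A and B, as the intersection of all subrings
   containing both. *)
Definition subring_join_pred A B : {pred S} :=
  [pred x | `[< forall C, {subset A <= C} -> {subset B <= C} -> x \in C >]].

Lemma subring_join_closed A B : subring_closed (subring_join_pred A B).
Proof.
split=> [|x y|x y].
- by apply/asboolP => C _ _; case: (subringP C).
- move=> /asboolP hx /asboolP hy; apply/asboolP => C AC BC.
  by case: (subringP C) => _ h _; apply: h; [exact: hx | exact: hy].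
- move=> /asboolP hx /asboolP hy; apply/asboolP => C AC BC.
  by case: (subringP C) => _ _; apply; [exact: hx | exact: hy].
Qed.

Definition subring_join A B := Subring (subring_join_closed A B).

Lemma subring_meetP C A B :
  (C <= subring_meet A B)%O = (C <= A)%O && (C <= B)%O.
Proof.
apply/asboolP/andP => [h|[/asboolP CA /asboolP CB] x Cx].
  by split; apply/asboolP => x /h /andP[].
by apply/andP; split; [exact: CA | exact: CB].
Qed.

Lemma subring_joinP A B C :
  (subring_join A B <= C)%O = (A <= C)%O && (B <= C)%O.
Proof.
apply/asboolP/andP => [h|[/asboolP AC /asboolP BC] x /asboolP]; last exact.
by split; apply/asboolP => x xA; apply/h/asboolP => D AD BD; [exact: AD|exact: BD].
Qed.

HB.instance Definition _ := @Order.POrder_MeetJoin_isLattice.Build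
  subring_display (subring S) subring_meet subring_join
  subring_meetP subring_joinP.

End SubringLattice.

(* 'M[R]_n is a pzRingType for every n (it is the trivial ring for n = 0). *)
Section StructuralMatrixRing.
Local Open Scope ring_scope.
Variables (R : nzRingType) (n : nat) (r : preorder_on 'I_n).

Definition structural_pred : {pred 'M[R]_n} :=
  [pred A : 'M[R]_n | [forall i, forall j, ~~ r i j ==> (A i j == 0)]].

Lemma structural_predP (A : 'M[R]_n) :
  reflect (forall i j, ~~ r i j -> A i j = 0) (A \in structural_pred).
Proof.
apply: (iffP forallP) => h i.
  by move=> j rij; move/forallP: (h i) => /(_ j); rewrite rij => /eqP.
by apply/forallP => j; apply/implyP => rij; apply/eqP/h.
Qed.

Lemma structural_closed : subring_closed structural_pred.
Proof.
split=> [|A B /structural_predP hA /structural_predP hB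
         |A B /structural_predP hA /structural_predP hB];
  apply/structural_predP => i j rij; rewrite !mxE.
- by case: eqP rij => // ->; rewrite (preorder_refl r j).
- by rewrite hA // hB // subrr.
- apply: big1 => k _; have [rik|/hA->] := boolP (r i k); last by rewrite mul0r.
  by rewrite hB ?mulr0 //; apply: contra rij; exact: preorder_trans.
Qed.

Definition structural_matrix_ring : subring 'M[R]_n :=
  Subring structural_closed.

End StructuralMatrixRing.

(* Main.v *)
Require Import Defs.
From HB Require Import structures.
From mathcomp Require Import all_boot all_order all_algebra.
From mathcomp Require Import boolp classical_sets cardinality.

(** Both halves of the theorem say that [M : r |-> M_n(r, R)] is one side of a
    Galois connection.

    A subring [B] lies in [M r] exactly when [r] holds at every position where
    some member of [B] is nonzero, that is, when [r] contains the pre-order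
    generated by these positions ([le_structural]).  So [M] is an upper adjoint
    and preserves all meets.

    Conversely, [M r] is spanned additively by the matrices [a *: E_ij] with
    [r i j].  Since [(a *: E_ij) * E_jk = a *: E_ik], the pairs [(i, j)] for
    which a subring [C] contains all the [a *: E_ij] form a transitive relation,
    which is a pre-order as soon as [C] contains the diagonal matrices; then
    [M r] lies in [C] exactly when [r] lies in this pre-order
    ([structural_le]).  So [M] behaves as a lower adjoint on the subrings above
    the diagonal ones, which are the only ones that matter for nonempty joins.
    The empty join is lost: the least subring need not contain all diagonal
    matrices.

    Finally [M] reflects the order, hence is injective, because [E_ij] belongs
    to [M r] only if [r i j]: this is where [1 <> 0] is used. *)

Set Implicit Arguments.
Unset Strict Implicit.
Unset Printing Implicit Defensive.

Import Order.Theory GRing.Theory.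
Local Open Scope ring_scope.

Section SubringClosure.
Variables (S : pzRingType) (C : subring S).

Lemma mem_subringM x y : x \in C -> y \in C -> x * y \in C.
Proof. by case: (subringP C) => _ _; apply. Qed.

Lemma mem_subring_sum (I : finType) (F : I -> S) :
  (forall i, F i \in C) -> \sum_i F i \in C.
Proof.
have [C0 CD] := GRing.zmod_closedD (GRing.subring_closedB (subringP C)).
by move=> FC; apply: (big_ind (fun x => x \in C)) => // x y; exact: CD.
Qed.

End SubringClosure.

Section StructuralAdjoints.
Variables (R : nzRingType) (n : nat).
Implicit Types (r s q : preorder_on 'I_n) (B C : subring 'M[R]_n).

Let M r : subring 'M[R]_n := structural_matrix_ring R r.

Lemma scale_delta_structural r i j a : r i j -> a *: delta_mx i j \in M r.
Proof.
move=> rij; apply/structural_predP => k l rkl; rewrite !mxE.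
have [/andP[/eqP ki /eqP lj]|_] := boolP ((k == i) && (l == j)).
  by rewrite ki lj rij in rkl.
by rewrite mulr0.
Qed.

Lemma structural_le_mono : {mono M : r s / (r <= s)%O}.
Proof.
move=> r s; apply/asboolP/preorder_leP => [rs i j rij|rs A].
  apply: contraT => sij.
  have /rs/structural_predP/(_ i j sij)/eqP := scale_delta_structural 1 rij.
  by rewrite !mxE !eqxx mulr1 oner_eq0.
move=> /structural_predP Ar; apply/structural_predP => i j sij.
by apply: Ar; apply: contra sij; exact: rs.
Qed.

(** The positions where members of [B] are nonzero need not form a reflexive or
    transitive relation; [B] is constrained through the closure only. *)
Definition support_preorder B : preorder_on 'I_n :=
  let supp : rel 'I_n :=
    [rel i j | `[< exists2 A : 'M[R]_n, A \in B & A i j != 0 >]] in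
  PreorderOn (@connect0 _ supp) (@connect_trans _ supp).

Lemma le_structural B r : (B <= M r)%O = (support_preorder B <= r)%O.
Proof.
apply/asboolP/preorder_leP => [BM i j|supp_r A BA].
  case/connectP => p; elim: p i => [|k p IH] i /=.
    by move=> _ ->; exact: preorder_refl.
  case/andP => /asboolP[A /BM/structural_predP Ar Aik] pk /(IH _ pk).
  by apply: preorder_trans; apply: contraNT Aik => /Ar ->.
apply/structural_predP => i j; apply: contraNeq => Aij.
by apply/supp_r/connect1/asboolP; exists A.
Qed.

Definition matrix_unit_rel C : rel 'I_n :=
  [rel i j | (i == j) || `[< forall a, a *: delta_mx i j \in C >]].

Lemma matrix_unit_refl C : reflexive (matrix_unit_rel C).
Proof. by move=> i; apply/orP; left. Qed.

Lemma matrix_unit_trans C : transitive (matrix_unit_rel C).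
Proof.
move=> j i k /predU1P[->//|/asboolP Cij] /predU1P[<-|/asboolP Cjk].
  by apply/orP; right; apply/asboolP.
apply/orP; right; apply/asboolP => a.
have := mem_subringM (Cij a) (Cjk 1).
by rewrite scale1r -[_ * _]scalemxAl mul_delta_mx.
Qed.

(** Reflexivity is imposed by hand, so that this is a pre-order for every [C];
    it is the honest relation once [C] contains the diagonal matrices. *)
Definition matrix_unit_preorder C : preorder_on 'I_n :=
  PreorderOn (@matrix_unit_refl C) (@matrix_unit_trans C).

(** Any [q] will do: its role is to put the diagonal matrices in [C].  The subring
    of scalar matrices shows that this cannot be dropped: for [1 < n] it
    contains no [M r], although the equality lies below every pre-order. *)
Lemma structural_le q C r :
  (M q <= C)%O -> (M r <= C)%O = (r <= matrix_unit_preorder C)%O.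
Proof.
move=> /asboolP qC; apply/asboolP/preorder_leP => [rC i j rij|rC A].
  apply/orP; right; apply/asboolP => a.
  by apply/rC/scale_delta_structural.
move=> /structural_predP Ar; rewrite [A]matrix_sum_delta.
apply: mem_subring_sum => i; apply: mem_subring_sum => j.
have [/rC/predU1P[<-|/asboolP//]|/Ar->] := boolP (r i j).
  exact/qC/scale_delta_structural/preorder_refl.
(* The zero summand is written as [0 *: delta_mx i i], which lies in [M q]. *)
rewrite scale0r -(scale0r (delta_mx i i)).
exact/qC/scale_delta_structural/preorder_refl.
Qed.

Lemma structural_meet : {morph M : r s / (r `&` s)%O >-> (r `&` s)%O}.
Proof.
move=> r s; apply/le_anti; rewrite lexI !structural_le_mono leIl leIr /=.
by rewrite le_structural lexI -!le_structural leIl leIr.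
Qed.

Lemma structural_join : {morph M : r s / (r `|` s)%O >-> (r `|` s)%O}.
Proof.
move=> r s; apply/le_anti; rewrite [X in _ && X]leUx !structural_le_mono.
have leMr := leUl (M r) (M s).
rewrite leUl leUr (structural_le _ leMr) leUx.
by rewrite -!(structural_le _ leMr) leMr leUr.
Qed.

Lemma structural_infimums (I : Type) (F : I -> preorder_on 'I_n) p :
  infimums (range F) p -> infimums (range (M \o F)) (M p).
Proof.
move=> [p_lb p_glb]; split=> [_ [k _ <-]|B B_lb] /=.
  by rewrite structural_le_mono; apply: p_lb; exists k.
rewrite le_structural; apply: p_glb => _ [k _ <-].
by rewrite -le_structural; apply: B_lb; exists k.
Qed.

(** A member of the family is needed to bring any upper bound above the diagonal
    matrices. *)
Lemma structural_supremums (I : Type) (F : I -> preorder_on 'I_n) p :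
  [set: I]%classic !=set0%classic ->
  supremums (range F) p -> supremums (range (M \o F)) (M p).
Proof.
move=> [k0 _] [p_ub p_lub]; split=> [_ [k _ <-]|C C_ub] /=.
  by rewrite structural_le_mono; apply: p_ub; exists k.
have FC k : (M (F k) <= C)%O by apply: C_ub; exists k.
rewrite (structural_le _ (FC k0)); apply: p_lub => _ [k _ <-].
by rewrite -(structural_le _ (FC k0)).
Qed.

End StructuralAdjoints.

Local Close Scope ring_scope.

Theorem proposition1 (R : nzRingType) (n : nat) (hn : (0 < n)%N) :
  let M : preorder_on 'I_n -> subring 'M[R]_n :=
    fun r => structural_matrix_ring R r in
  [/\ injective M,
      {morph M : r s / (r `&` s)%O >-> (r `&` s)%O},
      {morph M : r s / (r `|` s)%O >-> (r `|` s)%O},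
      (forall (I : Type) (F : I -> preorder_on 'I_n) (p : preorder_on 'I_n),
         infinite_set [set: I]%classic ->
         infimums (range F) p -> infimums (range (M \o F)) (M p))
    & (forall (I : Type) (F : I -> preorder_on 'I_n) (p : preorder_on 'I_n),
         infinite_set [set: I]%classic ->
         supremums (range F) p -> supremums (range (M \o F)) (M p)) ].
Proof.
split.
- exact: inc_inj (@structural_le_mono R n).
- exact: structural_meet.
- exact: structural_join.
- by move=> I F p _; exact: structural_infimums.
- move=> I F p /infinite_setN0 I0; exact: structural_supremums.
Qed.
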